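(* Let $\bar\sigma_4=\frac{-1-i\sqrt7}{2}$ and $p\in\{8,12\}$, and let $\Gamma=\mathcal{S}(p,\bar\sigma_4)$. Then $\Gamma$ is generated by the union $\mathrm{Stab}_\Gamma(m(R_1))\cup\mathrm{Stab}_\Gamma(m(A))$, where $A$ can be taken to be any one of the following elements (each of which is a complex reflection in $\Gamma$): $(R_1R_2R_3R_2^{-1})^3$, $(R_1R_3^{-1}R_2R_3)^3$, $(R_1R_3R_1R_2R_1^{-1}R_3^{-1})^3$.
   Context: Let $p\ge2$ be an integer and $\tau\in\mathbb{C}$. Set $u=e^{2\pi i/(3p)}$, $\alpha=2-u^3-\bar u^3$, $\beta=(\bar u^2-u)\tau$ and $H=\begin{pmatrix}\alpha&\beta&\bar\beta\\ \bar\beta&\alpha&\beta\\ \beta&\bar\beta&\alpha\end{pmatrix}$, a Hermitian matrix (of signature $(2,1)$ for the parameters considered) defining the form $\langle X,Y\rangle=Y^*HX$. Let $R_1=\begin{pmatrix}u^2&\tau&-u\bar\tau\\0&\bar u&0\\0&0&\bar u\end{pmatrix}$, $J=\begin{pmatrix}0&0&1\\1&0&0\\0&1&0\end{pmatrix}$, $R_2=JR_1J^{-1}$, $R_3=JR_2J^{-1}$. The group $\mathcal{S}(p,\tau)$ is the subgroup of $U(H)$ generated by $R_1$ and $J$, acting on $H^2_{\mathbb{C}}=\{[X]:\langle X,X\rangle<0\}$ through its image in $PU(H)$; all statements refer to this image. For a complex reflection $A$ (a non-identity element fixing pointwise a complex line), $m(A)$ denotes its mirror (that fixed complex line); $\mathrm{Stab}_\Gamma(m)$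 is the setwise stabilizer of $m$ in $\Gamma$. *)

(* Defs.v *)
(* + MathComp-Analysis (trig functions) + real_closed complex numbers. *)
From HB Require Import structures.
From mathcomp Require Import all_boot all_order all_algebra.
From mathcomp Require Import complex.
From mathcomp Require Import reals trigo.
Set Implicit Arguments. Unset Strict Implicit. Unset Printing Implicit Defensive.
Import Order.TTheory GRing.Theory Num.Theory.
Local Open Scope ring_scope.
Local Open Scope complex_scope.

Section Defs.
Variable R : realType.
Local Notation C := R[i].
Local Notation M := 'M[C]_3.
Local Notation V := 'cV[C]_3.

(* u = e^{2 pi i/(3p)} *)
Definition uu (p : nat) : C :=
  (cos (2 * pi / (3 * p)%:R)) +i* (sin (2 * pi / (3 * p)%:R)).

(* sigma4bar = (-1 - i sqrt 7)/2 *)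
Definition sigma4bar : C := (-1 / 2) +i* (- Num.sqrt 7 / 2).

(* conjugate transpose *)
Definition adjmx m n (A : 'M[C]_(m, n)) : 'M[C]_(n, m) := (map_mx Num.conj A)^T.

Definition alpha (p : nat) : C := 2 - (uu p) ^+ 3 - ((uu p)^*) ^+ 3.
Definition beta (p : nat) (tau : C) : C := (((uu p)^*) ^+ 2 - uu p) * tau.

Definition Hmx (p : nat) (tau : C) : M :=
  let a := alpha p in let b := beta p tau in let bb := b^* in
  \matrix_(i < 3, j < 3)
    (match nat_of_ord i, nat_of_ord j with
     | 0, 0 => a | 0, 1 => b | 0, _ => bb
     | 1, 0 => bb | 1, 1 => a | 1, _ => b
     | _, 0 => b | _, 1 => bb | _, _ => a end).

(* Hermitian form <X,Y> = Y^* H X *)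
Definition herm (p : nat) (tau : C) (X Y : V) : C := (adjmx Y *m Hmx p tau *m X) 0 0.

Definition R1mx (p : nat) (tau : C) : M :=
  let u := uu p in
  \matrix_(i < 3, j < 3)
    (match nat_of_ord i, nat_of_ord j with
     | 0, 0 => u ^+ 2 | 0, 1 => tau | 0, _ => - u * tau^*
     | 1, 1 => u^* | 2, 2 => u^* | _, _ => 0 end).

Definition Jmx : M :=
  \matrix_(i < 3, j < 3)
    (match nat_of_ord i, nat_of_ord j with
     | 0, 2 => 1 | 1, 0 => 1 | 2, 1 => 1 | _, _ => 0 end).

Definition R2mx p tau : M := Jmx *m R1mx p tau *m invmx Jmx.
Definition R3mx p tau : M := Jmx *m R2mx p tau *m invmx Jmx.

(* subgroup of GL_3(C) generated by a set S of matrices: finite products of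
   elements of S and their inverses *)
Inductive generated (S : M -> Prop) : M -> Prop :=
| gen_one : generated S 1%:M
| gen_mul : forall g s, generated S g -> S s -> generated S (g *m s)
| gen_mulV : forall g s, generated S g -> S s -> generated S (g *m invmx s).

(* the lift of S(p,tau) to matrices *)
Definition Gamma p tau : M -> Prop :=
  generated (fun g => g = R1mx p tau \/ g = Jmx).

(* the ball H^2_C, as the negative cone of vectors *)
Definition negvec p tau (X : V) : Prop := herm p tau X X < 0.

(* [A X] = [X] *)
Definition proj_fixed (A : M) (X : V) : Prop := exists c : C, A *m X = c *: X.

Definition is_scalar_mat (A : M) : Prop := exists c : C, A = c%:M.

(* A complex line of H^2_C: the negative points of a 2-dimensional subspace W
   (W given as the row space of the transpose of a 3x2 matrix of rank 2)
   meeting the negative cone. *)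
Definition in_span (W : 'M[C]_(3, 2)) (X : V) : Prop := exists a : 'cV[C]_2, X = W *m a.

Definition complex_line p tau (W : 'M[C]_(3, 2)) : Prop :=
  \rank W = 2%N /\ exists X, in_span W X /\ negvec p tau X.

(* complex reflection: non-identity element of PU(H) fixing pointwise a
   complex line *)
Definition is_complex_reflection p tau (A : M) : Prop :=
  ~ is_scalar_mat A /\
  exists W, complex_line p tau W /\
    forall X, in_span W X -> negvec p tau X -> proj_fixed A X.

(* the mirror m(A): the fixed point set of A in H^2_C (for a complex
   reflection this is exactly the fixed complex line) *)
Definition mirror p tau (A : M) : V -> Prop :=
  fun X => negvec p tau X /\ proj_fixed A X.

(* g maps the set m (of points of H^2_C, closed under nonzero scaling) onto itself *)
Definition stabilizes (g : M) (m : V -> Prop) : Prop :=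
  (forall X, m X -> m (g *m X)) /\ (forall Y, m Y -> exists X, m X /\ g *m X = Y).

Definition Stab p tau (m : V -> Prop) : M -> Prop :=
  fun g => Gamma p tau g /\ stabilizes g m.

(* Gamma (in PU(H)) is generated by the set S: every element of Gamma is,
   up to a nonzero scalar, in the group generated by S *)
Definition proj_generates p tau (S : M -> Prop) : Prop :=
  forall g, Gamma p tau g -> exists h c, generated S h /\ c != 0 /\ g = c *: h.

End Defs.

(* Main.v *)
(* Write x1 = R2 R3 R2^-1, x2 = R3^-1 R2 R3, x3 = (R3 R1) R2 (R3 R1)^-1, so that
   the three choices of A are A_i = (R1 x_i)^3.  The braid relation
   R1 x1 R1 = x1 R1 x1 makes A_1 commute with R1 and x1.  Conjugation by
   k = R3^-1 J maps the pair (x1, R1) to (R1, x2), and conjugation by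
   c = R3 R1 R3 fixes R1 and maps x2 to x3, so A_2 and A_3 are conjugates of A_1
   in Gamma, and A_i commutes with R1 and x_i.  The length 4 braid relations say
   that b = R2 R1 R2 and c commute with R1.  Elements commuting with a
   reflection stabilize its mirror, so it suffices to write J as a word in R1, b,
   c and x_i; this follows from (R1 J)^7 = 1:
     k = (R1 x1 b c)^-1 and J = x1^-1 k R1^-1 b,
     z = R2 R3 J = (c x2 R1)^-1 and J = R1^-1 c z b^-1 x2^-1.
   Finally A_1 is the scalar - u^3 on the plane spanned by the polar vectors of
   R1 and x1, which is hyperbolic because 2 cos (2 pi / p) > 1. *)
Require Import Defs.
From HB Require Import structures.
From mathcomp Require Import all_boot all_order all_algebra.
From mathcomp Require Import complex.
From mathcomp Require Import reals trigo.
From mathcomp Require Import ring lra.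
Import Order.TTheory GRing.Theory Num.Theory.
Local Open Scope ring_scope.

(** * Word identities under a rotation [J] that permutes [r1], [r2], [r3] cyclically *)

Section Words.
Variables (T : unitRingType) (r1 r2 r3 J : T).
Hypotheses (u1 : r1 \is a GRing.unit) (u2 : r2 \is a GRing.unit).
Hypotheses (u3 : r3 \is a GRing.unit) (uJ : J \is a GRing.unit).
Hypotheses (J12 : J * r1 = r2 * J) (J23 : J * r2 = r3 * J).
Hypothesis J31 : J * r3 = r1 * J.

Let x1 := r2 * r3 * r2^-1.
Let x2 := r3^-1 * r2 * r3.
Let x3 := r3 * r1 * r2 * r1^-1 * r3^-1.
Let b := r2 * r1 * r2.
Let c := r3 * r1 * r3.
Let k := r3^-1 * J.

Lemma unit_words : [/\ x1 \is a GRing.unit, x2 \is a GRing.unit,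
  b \is a GRing.unit, c \is a GRing.unit & k \is a GRing.unit].
Proof. by split; rewrite !unitrMl ?unitrV. Qed.

Lemma intertwineV (x y : T) : x \is a GRing.unit -> y \is a GRing.unit ->
  J * x = y * J -> J * x^-1 = y^-1 * J.
Proof.
by move=> ux uy e; apply: (mulrI uy); rewrite mulVKr // mulrA -e mulrK.
Qed.

Let push (x y : T) (e : J * x = y * J) a : a * J * x = a * y * J.
Proof. by rewrite -!mulrA e. Qed.

(* Rewriting with [red] puts every word in the form [w * J ^+ n], with [w]
   freely reduced in the [ri]. *)
Let red := (mulrA, (J12, J23, J31), (push _ _ J12, push _ _ J23, push _ _ J31),
  (intertwineV _ _ u1 u2 J12, intertwineV _ _ u2 u3 J23,
   intertwineV _ _ u3 u1 J31),
  (push _ _ (intertwineV _ _ u1 u2 J12), push _ _ (intertwineV _ _ u2 u3 J23),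
   push _ _ (intertwineV _ _ u3 u1 J31)),
  (mulrK u1, mulrK u2, mulrK u3), (mulrVK u1, mulrVK u2, mulrVK u3),
  (mulrV u1, mulrV u2, mulrV u3), (mulVr u1, mulVr u2, mulVr u3), @mul1r T).

Lemma k_conj_x1 : k * x1 = r1 * k.
Proof. by rewrite /k /x1 !red. Qed.

Lemma k_conj_r1 : k * r1 = x2 * k.
Proof. by rewrite /k /x2 !red. Qed.

Lemma c_conj_x2 : c * x2 = x3 * c.
Proof. by rewrite /c /x2 /x3 !red. Qed.

(** This encodes [(r1 * J) ^+ 7 = 1]: moving every [J] to the right leaves these seven letters
    followed by [J ^+ 7], which is [J] when [J ^+ 3 = 1]. *)
Hypothesis Pr7 : r1 * r2 * r3 * r1 * r2 * r3 * r1 * J = 1.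

(** Conjugating [Pr7] by [J] raises every index by one, cyclically. *)
Lemma word7_shift : r2 * r3 * r1 * r2 * r3 * r1 * r2 * J = 1.
Proof. by apply: (mulIr uJ); rewrite mul1r -{3}[J]mulr1 -Pr7 !red. Qed.

Lemma word7_shift2 : r3 * r1 * r2 * r3 * r1 * r2 * r3 * J = 1.
Proof. by apply: (mulIr uJ); rewrite mul1r -{3}[J]mulr1 -word7_shift !red. Qed.

Lemma eq_invr (x y : T) : x \is a GRing.unit -> x * y = 1 -> y = x^-1.
Proof. by move=> ux e; apply: (mulrI ux); rewrite mulrV. Qed.

(** [G] stands for the group generated by the two mirror stabilizers. *)
Variable G : T -> Prop.
Hypothesis GM : forall x y, G x -> G y -> G (x * y).
Hypothesis GV : forall x, G x -> G x^-1.
Hypotheses (G1 : G r1) (Gb : G b) (Gc : G c).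

Ltac closeG := repeat first [assumption | apply: GV | apply: GM].

Lemma rotation_of_x1 : r1 * b = b * r1 -> G x1 -> G J.
Proof.
move=> cb Gx; have [ux _ ub uc _] := unit_words.
have Gk : G k.
  suff -> : k = (r1 * x1 * b * c)^-1 by closeG.
  apply: eq_invr; first exact: rpredM (rpredM (rpredM u1 ux) ub) uc.
  (* The product [r1 * x1 * b * c * k] cancels freely to the word of [Pr7]. *)
  by rewrite -Pr7 /x1 /b /c /k !red.
suff -> : J = x1^-1 * (k * r1^-1 * b) by closeG.
apply: (mulrI ux); rewrite mulVKr //.
(* The braid relation lets [r1^-1] pass [b], and [k * b * r1^-1] is then [r3^-1 * (r3 * r2 * r3 *
   r2^-1) * J = x1 * J]. *)
have e : r1^-1 * b = b * r1^-1.
  by apply: (mulrI u1); rewrite mulVKr // mulrA cb mulrK.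
by rewrite -mulrA e /k /x1 /b !red.
Qed.

Lemma rotation_of_x2 : G x2 -> G J.
Proof.
move=> Gx; have [_ ux ub uc _] := unit_words.
have Gz : G (r2 * r3 * J).
  suff -> : r2 * r3 * J = (c * x2 * r1)^-1 by closeG.
  apply: eq_invr; first exact: rpredM (rpredM uc ux) u1.
  by rewrite -word7_shift2 /x2 /c !red.
suff -> : J = r1^-1 * (c * (r2 * r3 * J)) * b^-1 * x2^-1.
  by closeG.
(* Clearing inverses leaves [r1 * J * x2 * b = c * r2 * r3 * J]; both sides reduce to
   [r3 * r1 * r3 * r2 * r3 * J]. *)
apply: (mulIr ux); rewrite mulrVK //; apply: (mulIr ub); rewrite mulrVK //.
by apply: (mulrI u1); rewrite mulVKr // /x2 /b /c !red.
Qed.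

Lemma rotation_of_x3 : G x3 -> G J.
Proof.
move=> Gx; have [_ _ _ uc _] := unit_words.
apply: rotation_of_x2; suff -> : x2 = c^-1 * (x3 * c) by closeG.
by rewrite -c_conj_x2 mulKr.
Qed.

End Words.

(** * Commutation and conjugation in a ring *)

(** The element [d = r * x * r = x * r * x] exchanges [r] and [x] under conjugation, and
    [(r * x) ^+ 3 = d * d], so the cube commutes with both. *)
Lemma braid_commute (T : unitRingType) (r x : T) : r * x * r = x * r * x ->
  r * (r * x) ^+ 3 = (r * x) ^+ 3 * r /\ x * (r * x) ^+ 3 = (r * x) ^+ 3 * x.
Proof.
move=> e; have e3 : (r * x) ^+ 3 = (r * x * r) * (r * x * r).
  by rewrite [X in _ = _ * X]e !exprS expr0 mulr1 !mulrA.
have er : r * (r * x * r) = (r * x * r) * x by rewrite -!mulrA (mulrA x) -e !mulrA.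
have ex : x * (r * x * r) = (r * x * r) * r by rewrite !mulrA -e.
rewrite e3; split.
  by rewrite mulrA er -mulrA ex mulrA.
by rewrite mulrA ex -mulrA er mulrA.
Qed.

Lemma mulrV_eq (T : unitRingType) (r x y : T) :
  r \is a GRing.unit -> y * r = x -> x * r^-1 = y.
Proof. by move=> ur <-; rewrite mulrK. Qed.

Lemma intertwineM (T : pzSemiRingType) (g x y x' y' : T) :
  g * x = x' * g -> g * y = y' * g -> g * (x * y) = x' * y' * g.
Proof. by move=> ex ey; rewrite mulrA ex -mulrA ey mulrA. Qed.

Lemma intertwineX (T : pzSemiRingType) (g x y : T) n :
  g * x = y * g -> g * x ^+ n = y ^+ n * g.
Proof.
move=> e; elim: n => [|n IH]; first by rewrite !expr0 mulr1 mul1r.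
by rewrite !exprS mulrA e -!mulrA IH.
Qed.

Lemma commute_conj (T : unitRingType) (g x y x' y' : T) :
  g \is a GRing.unit -> g * x = x' * g -> g * y = y' * g ->
  y * x = x * y -> y' * x' = x' * y'.
Proof.
move=> ug ex ey e; apply: (mulIr ug).
by rewrite -!mulrA -ex -ey !mulrA -ey -ex -!mulrA e.
Qed.

(** [r] intertwines [x * r] with [r * x], so both powers agree once [r] commutes with one of them.
    This turns [(r1 * x1) ^+ 3] into the form that conjugation by [k] sends to [(r1 * x2) ^+ 3]. *)
Lemma expr_rotate (T : unitRingType) (r x : T) n : r \is a GRing.unit ->
  r * (r * x) ^+ n = (r * x) ^+ n * r -> (r * x) ^+ n = (x * r) ^+ n.
Proof.
by move=> ur e; apply: (mulrI ur); rewrite e (intertwineX _ _ _ (r * x)) ?mulrA.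
Qed.

(** * Explicit 3x3 matrices, whose identities reduce entrywise to [ring] *)

Definition mx3 (F : nzRingType) (a b c d e f g h k : F) : 'M[F]_3 :=
  \matrix_(i, j) match nat_of_ord i, nat_of_ord j with
    | 0, 0 => a | 0, 1 => b | 0, _ => c
    | 1, 0 => d | 1, 1 => e | 1, _ => f
    | _, 0 => g | _, 1 => h | _, _ => k end%N.

Arguments mx3 {F}.

Lemma mx3_mul (F : nzRingType) (a b c d e f g h k a' b' c' d' e' f' g' h' k' : F) :
  mx3 a b c d e f g h k * mx3 a' b' c' d' e' f' g' h' k' =
  mx3 (a * a' + b * d' + c * g') (a * b' + b * e' + c * h')
      (a * c' + b * f' + c * k')
      (d * a' + e * d' + f * g') (d * b' + e * e' + f * h')
      (d * c' + e * f' + f * k')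
      (g * a' + h * d' + k * g') (g * b' + h * e' + k * h')
      (g * c' + h * f' + k * k').
Proof.
apply/matrixP => i j; rewrite !mxE 3!big_ord_recl big_ord0 !mxE /= addr0 addrA.
by case: i => [[|[|[|i]]] Hi]; case: j => [[|[|[|j]]] Hj].
Qed.

Lemma mx3_1 (F : nzRingType) : 1 = mx3 1 0 0 0 1 0 0 0 1 :> 'M[F]_3.
Proof.
apply/matrixP => i j; rewrite !mxE.
by case: i => [[|[|[|i]]] Hi]; case: j => [[|[|[|j]]] Hj].
Qed.

Lemma mx3_scale (F : nzRingType) (x a b c d e f g h k : F) :
  x *: mx3 a b c d e f g h k =
  mx3 (x * a) (x * b) (x * c) (x * d) (x * e) (x * f) (x * g) (x * h) (x * k).
Proof.
apply/matrixP => i j; rewrite !mxE.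
by case: i => [[|[|[|i]]] Hi]; case: j => [[|[|[|j]]] Hj].
Qed.

(** * Relations and eigenvalues of the explicit matrices, over a commutative ring *)

Section Relations.
Variables (F : comUnitRingType) (u v t : F).
Hypotheses (uv1 : u * v = 1) (t2 : t ^+ 2 = - t - 2).

(* [v] and [-1 - t] play the roles of the conjugates of [u] and [t]. *)
Let r1 := mx3 (u ^+ 2) t (- u * (- 1 - t)) 0 v 0 0 0 v.
Let r2 := mx3 v 0 0 (- u * (- 1 - t)) (u ^+ 2) t 0 0 v.
Let r3 := mx3 v 0 0 0 v 0 t (- u * (- 1 - t)) (u ^+ 2).
Let J : 'M[F]_3 := mx3 0 0 1 1 0 0 0 1 0.
Let x1 := mx3 v 0 0 (u * t) (- v) ((u ^+ 3 + 1) * t)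
              1 (- v ^+ 2 * (- 1 - t)) (u ^+ 2 + v *+ 2).

Lemma rotation_cube : J * J * J = 1.
Proof. by rewrite !mx3_mul mx3_1; congr mx3; ring. Qed.

Lemma rotation_r1 : J * r1 = r2 * J.
Proof. by rewrite !mx3_mul; congr mx3; ring. Qed.

Lemma rotation_r2 : J * r2 = r3 * J.
Proof. by rewrite !mx3_mul; congr mx3; ring. Qed.

Lemma rotation_r3 : J * r3 = r1 * J.
Proof. by rewrite !mx3_mul; congr mx3; ring. Qed.

Lemma r1_unit : r1 * mx3 (v ^+ 2) (- v * t) (- 1 - t) 0 u 0 0 0 u = 1.
Proof. by rewrite !mx3_mul mx3_1; congr mx3; ring: uv1 t2. Qed.

(** This says without inverses that the explicit [x1] is [r2 * r3 * r2^-1]. *)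
Lemma x1E : x1 * r2 = r2 * r3.
Proof. by rewrite !mx3_mul; congr mx3; ring: uv1 t2. Qed.

Lemma braid3 : r1 * x1 * r1 = x1 * r1 * x1.
Proof. by rewrite !mx3_mul; congr mx3; ring: uv1 t2. Qed.

Lemma braid4_12 : r1 * (r2 * r1 * r2) = (r2 * r1 * r2) * r1.
Proof. by rewrite !mx3_mul; congr mx3; ring: uv1 t2. Qed.

Lemma braid4_13 : r1 * (r3 * r1 * r3) = (r3 * r1 * r3) * r1.
Proof. by rewrite !mx3_mul; congr mx3; ring: uv1 t2. Qed.

Lemma word7 : r1 * r2 * r3 * (r1 * r2 * r3) * (r1 * J) = 1.
Proof.
by rewrite !mx3_mul mx3_1; congr mx3; ring: uv1 t2.
Qed.

(* The columns of [E] are the polar vectors [e1] and [r2 e3] of [r1] and [x1],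
   and 0. *)
Let E := mx3 1 0 0 0 t 0 0 v 0.

Lemma cube_eigenplane : (r1 * x1) ^+ 3 * E = - u ^+ 3 *: E.
Proof.
(* [N] is the action of [r1 * x1] on the columns of [E]. Its nonzero block has trace [u] and
   determinant [u ^+ 2], and X^2 - uX + u^2 divides X^3 + u^3. *)
pose N := mx3 0 (- u ^+ 2) 0 1 u 0 0 0 0.
have yE : r1 * x1 * E = E * N.
  by rewrite !mx3_mul; congr mx3; ring: uv1 t2.
have y3E : (r1 * x1) ^+ 3 * E = E * (N * N * N).
  move: (r1 * x1) yE => y yE.
  rewrite !exprS expr0 mulr1 -!mulrA yE (mulrA y E) yE -mulrA (mulrA y E) yE.
  by rewrite -!mulrA.
by rewrite y3E !mx3_mul mx3_scale; congr mx3; ring: uv1 t2.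
Qed.

(** The row (0, v, -t) kills both columns of [E], so it detects the eigenvalue on the quotient by
    the plane: [v ^+ 2] for [r1 * x1]. *)
Lemma cube_left_eigenvector (w := mx3 0 v (- t) 0 0 0 0 0 0) :
  w * (r1 * x1) ^+ 3 = v ^+ 6 *: w.
Proof.
have wy : w * (r1 * x1) = v ^+ 2 *: w.
  by rewrite !mx3_mul mx3_scale; congr mx3; ring: uv1 t2.
move: w (r1 * x1) wy => {}w y wy.
rewrite !exprS expr0 mulr1 (mulrA w) wy -scalerAl (mulrA w) wy -scalerAl wy.
rewrite !scalerA; congr (_ *: _); ring.
Qed.
End Relations.

Local Open Scope complex_scope.

(** * The subgroup generated by a set of invertible matrices *)

Section Generated.
Variables (R : realType) (S : 'M[R[i]]_3 -> Prop).

Lemma generated_incl g : S g -> generated S g.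
Proof. by move=> Sg; rewrite -[g]mul1mx; apply: gen_mul => //; apply: gen_one. Qed.

Lemma generated_inclV g : S g -> generated S g^-1.
Proof. by move=> Sg; rewrite -[g^-1]mul1mx; apply: gen_mulV => //; apply: gen_one. Qed.

Lemma generated_mul g h : generated S g -> generated S h -> generated S (g * h).
Proof.
move=> Sg; elim=> [|{}h s _ IH Ss|{}h s _ IH Ss].
- by rewrite [_ * _]mulmx1.
- by rewrite [_ * _]mulmxA; apply: gen_mul.
- by rewrite [_ * _]mulmxA; apply: gen_mulV.
Qed.

Hypothesis S_unit : forall g, S g -> g \is a GRing.unit.

Lemma generated_unit g : generated S g -> g \is a GRing.unit.
Proof.
elim=> [|{}g s _ IH Ss|{}g s _ IH Ss]; first exact: unitr1.
- by rewrite (unitrMl _ (S_unit _ Ss)).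
- by rewrite unitrMl ?unitrV //; apply: S_unit.
Qed.

Lemma generated_inv g : generated S g -> generated S g^-1.
Proof.
elim=> [|{}g s Sg IH Ss|{}g s Sg IH Ss].
- by rewrite invr1; apply: gen_one.
- rewrite [_^-1]invrM; [|exact: generated_unit|exact: S_unit].
  by apply: generated_mul => //; apply: generated_inclV.
- rewrite [_^-1]invrM; [|exact: generated_unit|by rewrite unitrV S_unit].
  rewrite [s^-1^-1]invrK.
  by apply: generated_mul => //; apply: generated_incl.
Qed.

End Generated.

(** * Isometries of the Hermitian form and stabilizers of mirrors *)

Section Isometries.
Variables (R : realType) (p : nat).
Local Notation u := (uu R p).
Local Notation v := (Num.conj (uu R p)).
Local Notation t := (sigma4bar R).
Local Notation H := (Hmx p t).
Local Notation r1 := (R1mx p t).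
Local Notation r2 := (R2mx p t).
Local Notation r3 := (R3mx p t).
Local Notation J := (Jmx R).
Local Notation Gam := (Gamma p t).

Lemma uu_conj : u * v = 1.
Proof.
apply/eqP; rewrite eq_complex /=; apply/andP; split; apply/eqP; last by ring.
by rewrite -[RHS](cos2Dsin2 (2 * pi / (3 * p)%:R)); ring.
Qed.

Lemma sigma4bar_sqr : t ^+ 2 = - t - 2.
Proof.
have s7 : Num.sqrt 7 ^+ 2 = 7 :> R by rewrite sqr_sqrtr.
apply/eqP; rewrite expr2 eq_complex /=; apply/andP; split; apply/eqP.
  by field: s7.
by field.
Qed.

(** The conjugate is the other root of X^2 + X + 2. *)
Lemma sigma4bar_conj : Num.conj t = - 1 - t.
Proof.
apply/eqP; rewrite eq_complex /=; apply/andP; split; apply/eqP; by field.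
Qed.

Lemma R1mxE : r1 = mx3 (u ^+ 2) t (- u * (- 1 - t)) 0 v 0 0 0 v.
Proof.
apply/matrixP => i j; rewrite !mxE -sigma4bar_conj.
by case: i => [[|[|[|i]]] Hi]; case: j => [[|[|[|j]]] Hj].
Qed.

Lemma JmxE : J = mx3 0 0 1 1 0 0 0 1 0.
Proof.
apply/matrixP => i j; rewrite !mxE.
by case: i => [[|[|[|i]]] Hi]; case: j => [[|[|[|j]]] Hj].
Qed.

Lemma unit_of_mulr1 (g h : 'M[R[i]]_3) : g * h = 1 -> g \is a GRing.unit.
Proof. by case/mulmx1_unit. Qed.

Lemma Jmx_unit : J \is a GRing.unit.
Proof. by apply: (@unit_of_mulr1 _ (J * J)); rewrite mulrA JmxE rotation_cube. Qed.

Lemma R2mxE : r2 = mx3 v 0 0 (- u * (- 1 - t)) (u ^+ 2) t 0 0 v.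
Proof.
(* Multiplying by [J] on the right avoids computing [invmx J]. *)
apply: (mulrV_eq _ _ _ _ Jmx_unit).
by rewrite R1mxE JmxE; apply/esym/rotation_r1.
Qed.

Lemma R3mxE : r3 = mx3 v 0 0 0 v 0 t (- u * (- 1 - t)) (u ^+ 2).
Proof.
apply: (mulrV_eq _ _ _ _ Jmx_unit).
by rewrite R2mxE JmxE; apply/esym/rotation_r2.
Qed.

Lemma R1mx_unit : r1 \is a GRing.unit.
Proof.
apply: unit_of_mulr1; rewrite R1mxE; apply: r1_unit uu_conj sigma4bar_sqr.
Qed.

Lemma R2mx_unit : r2 \is a GRing.unit.
Proof.
have uV : J^-1 \is a GRing.unit by rewrite unitrV Jmx_unit.
exact: rpredM (rpredM Jmx_unit R1mx_unit) uV.
Qed.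

Lemma R3mx_unit : r3 \is a GRing.unit.
Proof.
have uV : J^-1 \is a GRing.unit by rewrite unitrV Jmx_unit.
exact: rpredM (rpredM Jmx_unit R2mx_unit) uV.
Qed.

Lemma Jmx_R1 : J * r1 = r2 * J.
Proof. by rewrite R1mxE R2mxE JmxE rotation_r1. Qed.

Lemma Jmx_R2 : J * r2 = r3 * J.
Proof. by rewrite R3mxE R2mxE JmxE rotation_r2. Qed.

Lemma Jmx_R3 : J * r3 = r1 * J.
Proof. by rewrite R1mxE R3mxE JmxE rotation_r3. Qed.

Definition isometry (g : 'M[R[i]]_3) := adjmx g *m H *m g = H.

Lemma adjmx_mul (m n k : nat) (A : 'M[R[i]]_(m, n)) (B : 'M[R[i]]_(n, k)) :
  adjmx (A *m B) = adjmx B *m adjmx A.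
Proof. by rewrite /adjmx map_mxM trmx_mul. Qed.

Lemma adjmx_mx3 (a b c d e f g h k : R[i]) :
  adjmx (mx3 a b c d e f g h k) =
  mx3 (Num.conj a) (Num.conj d) (Num.conj g)
      (Num.conj b) (Num.conj e) (Num.conj h)
      (Num.conj c) (Num.conj f) (Num.conj k).
Proof.
apply/matrixP => i j; rewrite !mxE.
by case: i => [[|[|[|i]]] Hi]; case: j => [[|[|[|j]]] Hj].
Qed.

Lemma conjcE : (forall x y : R[i], Num.conj (x * y) = Num.conj x * Num.conj y) *
  (forall x y : R[i], Num.conj (x - y) = Num.conj x - Num.conj y) *
  (forall x : R[i], Num.conj (- x) = - Num.conj x) *
  (forall (x : R[i]) n, Num.conj (x ^+ n) = Num.conj x ^+ n) *
  (forall x : R[i], Num.conj (Num.conj x) = x) *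
  (Num.conj (0 : R[i]) = 0) * (Num.conj (1 : R[i]) = 1) *
  (Num.conj t = - 1 - t).
Proof.
split; last exact: sigma4bar_conj.
do !split; [exact: rmorphM|exact: rmorphB|exact: rmorphN|move=> x n; exact: rmorphXn|
  exact: conjcK|exact: rmorph0|exact: rmorph1].
Qed.

Lemma HmxE (a b b' : R[i]) :
  a = 2 - u ^+ 3 - v ^+ 3 -> b = (v ^+ 2 - u) * t ->
  b' = (u ^+ 2 - v) * (- 1 - t) -> H = mx3 a b b' b' a b b b' a.
Proof.
move=> -> -> ->.
have <- : Num.conj ((v ^+ 2 - u) * t) = (u ^+ 2 - v) * (- 1 - t) by rewrite !conjcE.
apply/matrixP => i j; rewrite !mxE.
by case: i => [[|[|[|i]]] Hi]; case: j => [[|[|[|j]]] Hj].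
Qed.

Lemma isometry_R1 : isometry r1.
Proof.
have uv := uu_conj; have t2 := sigma4bar_sqr.
rewrite /isometry !mulmxE (HmxE _ _ _ erefl erefl erefl) R1mxE adjmx_mx3 !mx3_mul.
by rewrite !conjcE; congr mx3; ring: uv t2.
Qed.

Lemma isometry_J : isometry J.
Proof.
rewrite /isometry !mulmxE (HmxE _ _ _ erefl erefl erefl) JmxE adjmx_mx3 !mx3_mul.
by rewrite !conjcE; congr mx3; ring.
Qed.

Lemma isometry_mul g h : isometry g -> isometry h -> isometry (g * h).
Proof.
rewrite /isometry -mulmxE adjmx_mul => eg eh.
by rewrite !mulmxA -2!(mulmxA (adjmx h)) eg.
Qed.

Lemma isometry_inv g : g \is a GRing.unit -> isometry g -> isometry g^-1.
Proof.
move=> ug; have gV : g *m g^-1 = 1%:M by apply: mulrV.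
(* Replacing the inner [H] by its pullback under [g] makes [g] meet [g^-1] on both sides. *)
rewrite /isometry => {1}<-; rewrite !mulmxA -adjmx_mul -(mulmxA _ g) gV mulmx1.
by rewrite /adjmx map_mx1 trmx1 mul1mx.
Qed.

Lemma Gamma_gen_unit g : g = r1 \/ g = J -> g \is a GRing.unit.
Proof. by case=> ->; [apply: R1mx_unit | apply: Jmx_unit]. Qed.

Lemma Gamma_unit g : Gam g -> g \is a GRing.unit.
Proof. by apply: generated_unit; apply: Gamma_gen_unit. Qed.

Lemma GammaM g h : Gam g -> Gam h -> Gam (g * h).
Proof. exact: generated_mul. Qed.

Lemma GammaV g : Gam g -> Gam g^-1.
Proof. by apply: generated_inv; apply: Gamma_gen_unit. Qed.

Lemma Gamma_R1 : Gam r1.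
Proof. by apply: generated_incl; left. Qed.

Lemma Gamma_J : Gam J.
Proof. by apply: generated_incl; right. Qed.

Lemma Gamma_R2 : Gam r2.
Proof.
by apply: GammaM; [apply: GammaM | apply: GammaV];
  do ?[exact: Gamma_R1 | exact: Gamma_J].
Qed.

Lemma Gamma_R3 : Gam r3.
Proof.
by apply: GammaM; [apply: GammaM | apply: GammaV];
  do ?[exact: Gamma_R2 | exact: Gamma_J].
Qed.

Lemma Gamma_isometry g : Gam g -> isometry g.
Proof.
have iso s : s = r1 \/ s = J -> isometry s.
  by case=> ->; [apply: isometry_R1 | apply: isometry_J].
elim=> [|{}g s _ IH Ss|{}g s _ IH Ss].
- by rewrite /isometry /adjmx map_mx1 trmx1 mul1mx mulmx1.
- by apply: isometry_mul => //; apply: iso.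
- by apply: isometry_mul => //; apply: isometry_inv; [apply: Gamma_gen_unit | apply: iso].
Qed.

Lemma negvec_Gamma g X : Gam g -> negvec p t X -> negvec p t (g *m X).
Proof.
move=> /Gamma_isometry ig; rewrite /negvec /herm.
suff -> : adjmx (g *m X) *m H *m (g *m X) = adjmx X *m H *m X by [].
by rewrite adjmx_mul !mulmxA -2!(mulmxA (adjmx X)) ig.
Qed.

(** An element commuting with [A] preserves its eigenvectors, and an isometry preserves negativity;
    the same argument for [g^-1] gives surjectivity. *)
Lemma Stab_mirror g A : Gam g -> g * A = A * g -> Stab p t (mirror p t A) g.
Proof.
move=> Gg e; have ug := Gamma_unit _ Gg.
have fix_g h X : h * A = A * h -> proj_fixed A X -> proj_fixed A (h *m X).
  move=> eh [x AX]; exists x.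
  by rewrite mulmxA -[A *m h]eh -mulmxA AX scalemxAr.
have eV : g^-1 * A = A * g^-1.
  by apply: (mulrI ug); rewrite mulVKr // mulrA e mulrK.
split=> //; split=> [X [nX fX]|Y [nY fY]].
  by split; [apply: negvec_Gamma | apply: fix_g].
exists (g^-1 *m Y); split; last by rewrite mulmxA mulmxV // mul1mx.
by split; [apply: negvec_Gamma => //; apply: GammaV | apply: fix_g].
Qed.

(** * The angle 2 pi / p *)

Lemma uu_cube : u ^+ 3 = cos (2 * pi / p%:R) +i* sin (2 * pi / p%:R).
Proof.
pose x : R := 2 * pi / (3 * p)%:R.
have -> : 2 * pi / p%:R = x + x + x.
  (* For [p = 0] both sides vanish, as division by zero gives zero. *)
  rewrite /x natrM; have [->|p0] := eqVneq (p%:R : R) 0.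
    by rewrite mulr0 invr0 !mulr0 !addr0.
  by field; rewrite p0.
rewrite !(cosD, sinD) !exprS expr0 mulr1 -/x.
by apply/eqP; rewrite eq_complex /= -/x; apply/andP; split; apply/eqP; ring.
Qed.

Hypothesis hp : p = 8%N \/ p = 12%N.

(** The angle x is pi/4 or pi/6; cos 2x = 0 or cos 3x = 0 determines the square of cos x. *)
Lemma cos_bounds : 2^-1 < cos (2 * pi / p%:R : R) < 1.
Proof.
have pi0 := pi_gt0 R; set x : R := 2 * pi / p%:R.
have cos0 : 0 < cos x.
  by apply: cos_gt0_pihalf; rewrite /x; case: hp => ->; lra.
suff : cos x ^+ 2 = 1 / 2 \/ cos x ^+ 2 = 3 / 4.
  by case=> e; apply/andP; split; nra.
have s2 := sin2cos2 x; case: hp => e; [left|right].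
  have : cos (x + x) = 0.
    by rewrite (_ : x + x = pi / 2) ?cos_pihalf // /x e; field.
  by rewrite cosD -!expr2 s2; lra.
have : cos (x + x + x) = 0.
  by rewrite (_ : x + x + x = pi / 2) ?cos_pihalf // /x e; field.
rewrite !(cosD, sinD) => e0.
have : cos x * (4 * cos x ^+ 2 - 3) = 0 by rewrite -e0; ring: s2.
by move/eqP; rewrite mulf_eq0 gt_eqF //= subr_eq0 => /eqP ?; lra.
Qed.
End Isometries.

(** * The cube [(r1 * x1) ^+ 3] is a complex reflection *)

Section Reflections.
Variables (R : realType) (p : nat).
Local Notation u := (uu R p).
Local Notation v := (Num.conj (uu R p)).
Local Notation t := (sigma4bar R).
Local Notation r1 := (R1mx p t).
Local Notation r2 := (R2mx p t).
Local Notation r3 := (R3mx p t).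
Local Notation J := (Jmx R).
Local Notation Gam := (Gamma p t).
Hypothesis hp : p = 8%N \/ p = 12%N.

Lemma uu_cubeD : u ^+ 3 + v ^+ 3 = (2 * cos (2 * pi / p%:R))%:C.
Proof.
have -> : v ^+ 3 = Num.conj (u ^+ 3) by rewrite rmorphXn.
by rewrite uu_cube; apply/eqP; rewrite eq_complex /=; apply/andP; split; apply/eqP; ring.
Qed.

Lemma alphaE : 2 - u ^+ 3 - v ^+ 3 = (2 - 2 * cos (2 * pi / p%:R))%:C.
Proof. by rewrite -addrA -opprD uu_cubeD rmorphB rmorph_nat. Qed.

(** With z = u^3, equality would mean z^3 = -1, so z = -1 or z + 1/z = 1; both contradict cos (2 pi
    / p) > 1/2. *)
Lemma uu_root_neq : v ^+ 6 <> - u ^+ 3.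
Proof.
have uv := uu_conj R p; have /andP[q1 q2] := cos_bounds R p hp.
move=> e; have : (u ^+ 3 + 1) * (u ^+ 3 + v ^+ 3 - 1) = 0.
  have : v ^+ 6 * u ^+ 6 = - u ^+ 9 by rewrite e; ring.
  rewrite (_ : v ^+ 6 * u ^+ 6 = 1); last by ring: uv.
  move=> e9; have : (u ^+ 3 + v ^+ 3 - 1) * (u ^+ 3 + 1) =
    v ^+ 3 * (1 + u ^+ 9) by ring: uv.
  by rewrite e9 addNr mulr0 mulrC.
move/eqP; rewrite mulf_eq0 {e uv} => /orP[]; last first.
  rewrite uu_cubeD subr_eq0 eq_complex /= => /andP[/eqP ? _]; lra.
rewrite uu_cube eq_complex /= => /andP[/eqP ? _]; lra.
Qed.

Let x1 := r2 * r3 * r2^-1.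

Lemma x1mxE : x1 = mx3 v 0 0 (u * t) (- v) ((u ^+ 3 + 1) * t)
                       1 (- v ^+ 2 * (- 1 - t)) (u ^+ 2 + v *+ 2).
Proof.
apply: (mulrV_eq _ _ _ _ (R2mx_unit R p)).
rewrite R2mxE R3mxE.
by apply: x1E; [apply: uu_conj | apply: sigma4bar_sqr].
Qed.

(* The plane spanned by [e1] and [r2 e3] is hyperbolic because the vector
   [alpha (r2 e3) - <r2 e3, e1> e1] has norm [alpha ^ 2 (alpha - 1) < 0]; the
   cube is not scalar because its eigenvalues are [- u ^ 3] (twice) and
   [u ^ -6]. *)
Lemma cube_reflection : is_complex_reflection p t ((r1 * x1) ^+ 3).
Proof.
have uv := uu_conj R p; have t2 := sigma4bar_sqr R.
split.
  case=> s As; apply: uu_root_neq.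
  have := cube_eigenplane _ _ _ _ uv t2; have := cube_left_eigenvector _ _ _ _ uv t2.
  rewrite -R1mxE -x1mxE As => wA AE; move: (wA : _ *m s%:M = _) (AE : s%:M *m _ = _).
  rewrite mul_mx_scalar mul_scalar_mx !mx3_scale.
  (* Entry (0, 1) gives [s * v = v ^+ 6 * v], and entry (0, 0) of the other equation gives
     [s = - u ^+ 3]. *)
  move=> /matrixP/(_ 0 1); rewrite !mxE /= => e1.
  move=> /matrixP/(_ 0 0); rewrite !mxE /= !mulr1 => <-.
  have vu : v * u = 1 by rewrite mulrC.
  by rewrite -[RHS]mulr1 -[in RHS]vu mulrA e1 -mulrA vu mulr1.
set E := mx3 1 0 0 0 t 0 0 v 0.
pose W : 'M[R[i]]_(3, 2) := E *m pid_mx 2.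
have AW : (r1 * x1) ^+ 3 *m W = - u ^+ 3 *: W.
  have := cube_eigenplane _ _ _ _ uv t2; rewrite -R1mxE -x1mxE => AE.
  by rewrite mulmxA [_ *m E]AE scalemxAl.
exists W; split; last first.
  by move=> X [a ->] _; exists (- u ^+ 3); rewrite mulmxA AW scalemxAl.
split.
  apply/eqP; rewrite eqn_leq rank_leq_col.
  (* [L] inverts [W] on the left, up to a zero row, because [u * v = 1]; hence [W] has rank 2. *)
  pose L : 'M[R[i]]_3 := mx3 1 0 0 0 0 u 0 0 0.
  apply: leq_trans (mxrankM_maxr L W).
  have -> : L *m W = pid_mx 2.
    rewrite mulmxA [L *m E]mx3_mul; apply/matrixP => i j.
    rewrite !mxE 3!big_ord_recl big_ord0 !mxE /=.
    case: i => [[|[|[|i]]] Hi] //; case: j => [[|[|j]] Hj] //=;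
      rewrite /bump /=; ring: uv.
  by rewrite rank_pid_mx.
(* Since <r2 e3, e1> = u - v^2, these are the coordinates of the part of alpha (r2 e3) orthogonal to
   e1. *)
pose a : 'cV[R[i]]_2 := \col_i (if i == 0 then v ^+ 2 - u else 2 - u ^+ 3 - v ^+ 3).
exists (W *m a); split; first by exists a.
have XE : W *m a = \col_(i < 3) match nat_of_ord i with O => v ^+ 2 - u
    | S O => t * (2 - u ^+ 3 - v ^+ 3) | _ => v * (2 - u ^+ 3 - v ^+ 3) end.
  apply/matrixP => i j; rewrite !mxE !big_ord_recl big_ord0 !mxE /=.
  rewrite !big_ord_recl !big_ord0 !mxE /=.
  by case: i => [[|[|[|i]]] Hi] //=; ring.
have hE : herm p t (W *m a) (W *m a) =
    (2 - u ^+ 3 - v ^+ 3) ^+ 2 * (1 - u ^+ 3 - v ^+ 3).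
  rewrite XE /herm (HmxE _ _ _ _ _ erefl erefl erefl) mxE !big_ord_recl big_ord0 !mxE /=.
  rewrite !big_ord_recl !big_ord0 !mxE /= !conjcE.
  ring: uv t2.
rewrite /negvec hE (_ : 1 - u ^+ 3 - v ^+ 3 = (2 - u ^+ 3 - v ^+ 3) - 1); last by ring.
rewrite alphaE; have /andP[] := cos_bounds R p hp.
move: (cos _) => q q1 q2; clear -q1 q2; set y : R := 2 - 2 * q.
have -> : y%:C ^+ 2 * (y%:C - 1) = (y ^+ 2 * (y - 1))%:C.
  by apply/eqP; rewrite !expr2 eq_complex /=; apply/andP; split; apply/eqP; ring.
rewrite ltcE /= eqxx /= pmulr_rlt0 ?exprn_gt0 // /y; lra.
Qed.

(** The plane fixed by [A] is carried by the isometry [g] to one fixed by [B]. *)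
Lemma reflection_conj (g A B : 'M[R[i]]_3) : Gam g -> g *m A = B *m g ->
  is_complex_reflection p t A -> is_complex_reflection p t B.
Proof.
move=> Gg e [nsA [W [[rW [Y [[a Ya] nY]]] fixW]]].
have ug : g \in unitmx := Gamma_unit _ _ _ Gg.
have GV : Gam (invmx g) := GammaV _ _ _ Gg.
split.
  case=> s Bs; apply: nsA; exists s.
  by rewrite -(mulKmx ug A) e Bs mul_scalar_mx -scalemxAr mulVmx // scalemx1.
exists (g *m W); split.
  split; first by rewrite (eqmxMfull W _) // row_full_unit.
  by exists (g *m Y); split; [exists a; rewrite Ya mulmxA | apply: negvec_Gamma].
move=> X [x Xx] nX; case: (fixW (invmx g *m X)) => [||z AX].
- by exists x; rewrite Xx -mulmxA mulKmx.
- exact: negvec_Gamma GV nX.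
exists z; rewrite -[in LHS](mulKVmx ug X) (mulmxA B) -e -mulmxA AX.
by rewrite -scalemxAr mulKVmx.
Qed.

(** * Generation by the two stabilizers, for each of the three reflections *)

Let b := r2 * r1 * r2.
Let c := r3 * r1 * r3.
Let x2 := r3^-1 * r2 * r3.
Let x3 := r3 * r1 * r2 * r1^-1 * r3^-1.

Lemma Gamma_words :
  [/\ Gam b, Gam c & Gam (r3^-1 * J)] /\ [/\ Gam x1, Gam x2 & Gam x3].
Proof.
have [G1 G2 G3] := And3 (Gamma_R1 R p) (Gamma_R2 R p) (Gamma_R3 R p).
have [V1 V2 V3] := And3 (GammaV _ _ _ G1) (GammaV _ _ _ G2) (GammaV _ _ _ G3).
have M := fun g h => GammaM R p g h.
split; split.
- exact: M (M _ _ G2 G1) G2.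
- exact: M (M _ _ G3 G1) G3.
- exact: M V3 (Gamma_J R p).
- exact: M (M _ _ G2 G3) V2.
- exact: M (M _ _ V3 G2) G3.
- exact: M (M _ _ (M _ _ (M _ _ G3 G1) G2) V1) V3.
Qed.

Lemma commute_b : r1 * b = b * r1.
Proof.
rewrite /b R1mxE R2mxE.
by apply: braid4_12; [apply: uu_conj | apply: sigma4bar_sqr].
Qed.

Lemma commute_c : r1 * c = c * r1.
Proof.
rewrite /c R1mxE R3mxE.
by apply: braid4_13; [apply: uu_conj | apply: sigma4bar_sqr].
Qed.

Lemma R123_word : r1 * r2 * r3 * r1 * r2 * r3 * r1 * J = 1.
Proof.
have assoc (T : pzSemiRingType) (w x y z : T) :
  w * x * y * w * x * y * w * z = w * x * y * (w * x * y) * (w * z).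
  by rewrite !mulrA.
rewrite assoc R1mxE R2mxE R3mxE JmxE.
by apply: word7; [apply: uu_conj | apply: sigma4bar_sqr].
Qed.

(** By commutation [r1], [b], [c] stabilize the mirror of [r1], and [x] that of [A]. The hypothesis
    on [G] is the shape of the three word lemmas; it yields [J], hence both generators of Gamma. *)
Lemma generates_of_rotation A x : Gam x -> r1 * A = A * r1 -> x * A = A * x ->
  (forall G : 'M[R[i]]_3 -> Prop, (forall g h, G g -> G h -> G (g * h)) ->
     (forall g, G g -> G g^-1) -> G r1 -> G b -> G c -> G x -> G J) ->
  proj_generates p t
    (fun g => Stab p t (mirror p t r1) g \/ Stab p t (mirror p t A) g).
Proof.
move=> Gx e1 ex rot g Gg.
set S : 'M[R[i]]_3 -> Prop := fun h => Stab p t (mirror p t r1) h \/ _.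
have [[Gb Gc _] _] := Gamma_words; have GJ := Gamma_J R p.
have S_unit h : S h -> h \is a GRing.unit.
  by move=> [[Gh _]|[Gh _]]; apply: Gamma_unit Gh.
have S1 h : Gam h -> h * r1 = r1 * h -> generated S h.
  by move=> Gh e; apply: generated_incl; left; apply: Stab_mirror.
have Sr : generated S r1 by apply: S1 => //; apply: Gamma_R1.
have SJ : generated S J.
  apply: rot => //.
  - by move=> *; apply: generated_mul.
  - by move=> *; apply: generated_inv.
  - by apply: S1; rewrite ?commute_b.
  - by apply: S1; rewrite ?commute_c.
  - by apply: generated_incl; right; apply: Stab_mirror.
(* Generation already holds for matrices, so the scalar is 1. *)
exists g, 1; rewrite oner_neq0 scale1r; split=> //.
elim: Gg => [|{}g s _ IH Ss|{}g s _ IH Ss]; first exact: gen_one.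
  by apply: generated_mul => //; case: Ss => ->.
by apply: generated_mul => //; apply: generated_inv => //; case: Ss => ->.
Qed.

Let A1 := (r1 * x1) ^+ 3.
Let A2 := (r1 * x2) ^+ 3.
Let A3 := (r1 * x3) ^+ 3.

Lemma commute_A1 : r1 * A1 = A1 * r1 /\ x1 * A1 = A1 * x1.
Proof.
apply: braid_commute; rewrite x1mxE R1mxE.
by apply: braid3; [apply: uu_conj | apply: sigma4bar_sqr].
Qed.

Lemma k_words : let k := r3^-1 * J in
  [/\ k \is a GRing.unit, k * r1 = x2 * k & k * x1 = r1 * k].
Proof.
have [[_ _ Gk] _] := Gamma_words; have uk := Gamma_unit _ _ _ Gk.
split=> //; [apply: k_conj_r1 | apply: k_conj_x1];
  do ?[exact: R1mx_unit | exact: R2mx_unit | exact: R3mx_unit |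
       exact: Jmx_unit | exact: Jmx_R1 | exact: Jmx_R2 | exact: Jmx_R3].
Qed.

Lemma conj_A1 : r3^-1 * J * A1 = A2 * (r3^-1 * J).
Proof.
have [_ kr kx] := k_words; have [e _] := commute_A1.
have -> : A1 = (x1 * r1) ^+ 3 := expr_rotate _ _ _ _ (R1mx_unit R p) e.
exact: intertwineX (intertwineM _ _ _ _ _ _ kx kr).
Qed.

Lemma c_words : c \is a GRing.unit /\ c * x2 = x3 * c.
Proof.
have [[_ Gc _] _] := Gamma_words; split; first exact: Gamma_unit Gc.
by apply: c_conj_x2; [apply: R1mx_unit | apply: R3mx_unit].
Qed.

Lemma conj_A2 : c * A2 = A3 * c.
Proof.
have [_ e] := c_words.
exact: intertwineX (intertwineM _ _ _ _ _ _ (esym commute_c) e).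
Qed.

Lemma commute_A2 : r1 * A2 = A2 * r1 /\ x2 * A2 = A2 * x2.
Proof.
have [uk kr kx] := k_words; have [e1 ex] := commute_A1.
by split; apply: commute_conj uk conj_A1 _ _; eassumption.
Qed.

Lemma commute_A3 : r1 * A3 = A3 * r1 /\ x3 * A3 = A3 * x3.
Proof.
have [uc cx] := c_words; have [e1 ex] := commute_A2.
split; first exact: commute_conj uc conj_A2 (esym commute_c) e1.
exact: commute_conj uc conj_A2 cx ex.
Qed.

Lemma reflection_A2 : is_complex_reflection p t A2.
Proof.
have [[_ _ Gk] _] := Gamma_words.
exact: reflection_conj Gk conj_A1 cube_reflection.
Qed.

Lemma reflection_A3 : is_complex_reflection p t A3.
Proof.
have [[_ Gc _] _] := Gamma_words.
exact: reflection_conj Gc conj_A2 reflection_A2.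
Qed.

Let T A := is_complex_reflection p t A /\ proj_generates p t
    (fun g => Stab p t (mirror p t r1) g \/ Stab p t (mirror p t A) g).

Let u1 := R1mx_unit R p.
Let u2 := R2mx_unit R p.
Let u3 := R3mx_unit R p.
Let uJ := Jmx_unit R.
Let J12 := Jmx_R1 R p.
Let J23 := Jmx_R2 R p.
Let J31 := Jmx_R3 R p.

Lemma generated_A1 : T A1.
Proof.
have [_ [Gx _ _]] := Gamma_words; have [e1 ex] := commute_A1.
split; first exact: cube_reflection.
apply: (generates_of_rotation _ _ Gx e1 ex) => G GM GV G1 Gb Gc.
exact: (rotation_of_x1 _ r1 r2 r3 J u1 u2 u3 uJ J12 J23 R123_word G GM GV
  G1 Gb Gc commute_b).
Qed.

Lemma generated_A2 : T A2.
Proof.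
have [_ [_ Gx _]] := Gamma_words; have [e1 ex] := commute_A2.
split; first exact: reflection_A2.
apply: (generates_of_rotation _ _ Gx e1 ex) => G GM GV G1 Gb Gc.
exact: (rotation_of_x2 _ r1 r2 r3 J u1 u2 u3 uJ J12 J23 J31 R123_word G GM GV
  G1 Gb Gc).
Qed.

Lemma generated_A3 : T A3.
Proof.
have [_ [_ _ Gx]] := Gamma_words; have [e1 ex] := commute_A3.
split; first exact: reflection_A3.
apply: (generates_of_rotation _ _ Gx e1 ex) => G GM GV G1 Gb Gc.
exact: (rotation_of_x3 _ r1 r2 r3 J u1 u2 u3 uJ J12 J23 J31 R123_word G GM GV
  G1 Gb Gc).
Qed.

End Reflections.

Local Close Scope complex_scope.

Theorem theorem11p1 (R : realType) (p : nat) (hp : p = 8%N \/ p = 12%N)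
  (A : 'M[R[i]]_3) :
  let tau := sigma4bar R in
  let R1 := R1mx p tau in let R2 := R2mx p tau in let R3 := R3mx p tau in
  A = (R1 *m R2 *m R3 *m invmx R2) ^+ 3 \/
  A = (R1 *m invmx R3 *m R2 *m R3) ^+ 3 \/
  A = (R1 *m R3 *m R1 *m R2 *m invmx R1 *m invmx R3) ^+ 3 ->
  is_complex_reflection p tau A /\
  proj_generates p tau
    (fun g => Stab p tau (mirror p tau R1) g \/ Stab p tau (mirror p tau A) g).
Proof.
(* Reassociation displays each given word as [R1] times a conjugate of a generator. *)
have assoc4 (T : pzSemiRingType) (a b c d : T) : a * b * c * d = a * (b * c * d).
  by rewrite !mulrA.
have assoc6 (T : pzSemiRingType) (a b c d e f : T) :
  a * b * c * d * e * f = a * (b * c * d * e * f).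
  by rewrite !mulrA.
move=> tau R1 R2 R3 [->|[->|->]].
- by rewrite [_ *m invmx R2](assoc4 _ R1 R2 R3 R2^-1); apply: generated_A1.
- by rewrite [_ *m R3](assoc4 _ R1 R3^-1 R2 R3); apply: generated_A2.
- rewrite [_ *m invmx R3](assoc6 _ R1 R3 R1 R2 R1^-1 R3^-1).
  exact: generated_A3.
Qed.
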